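(* There is an algorithm which, given a lattice polygon $P\subset\mathbb{R}^2$, decides in time polynomial in $|P\cap\mathbb{Z}^2|$ whether there is a maximal Minkowski decomposition in $P$ one of whose summands is an exceptional triangle.
   Context: A lattice polytope in $\mathbb{R}^2$ is the convex hull of a nonempty finite subset of $\mathbb{Z}^2$; a lattice polygon is one of dimension 2. For a lattice polytope $Q$, the Minkowski length $\ell(Q)$ is the largest number of summands in a Minkowski decomposition $Q=Q_1+\dots+Q_\ell$ into lattice polytopes of positive dimension ($0$ if $Q$ is a point). The full Minkowski length of $P$ is $L(P)=\max\{\ell(Q) : Q\subseteq P\text{ a lattice polytope}\}$. A maximal Minkowski decomposition in $P$ is a decomposition $Q=Q_1+\dots+Q_{L(P)}$ of some lattice polytope $Q\subseteq P$ into $L(P)$ lattice polytopes of positive dimension. $\mathrm{AGL}(2,\mathbb{Z})$ is the group of maps $x\mapsto Mx+b$ with $M\in\mathrm{GL}(2,\mathbb{Z})$, $b\in\mathbb{Z}^2$. An exceptional triangle is a lattice triangle $\mathrm{AGL}(2,\mathbb{Z})$-equivalent to the triangle $T_0$ with vertices $(1,0),(0,1),(2,2)$. The polygon may be taken to be given by the list of its lattice points, and running time is measured by the number of elementary operations (arithmetic and comparisons) on integers. *)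

(* Defs.v *)
From mathcomp Require Import all_boot all_order all_algebra.
From mathcomp Require Import boolp classical_sets reals.

Set Implicit Arguments.
Unset Strict Implicit.
Unset Printing Implicit Defensive.

Import GRing.Theory Num.Theory.
Local Open Scope classical_set_scope.
Local Open Scope ring_scope.

(** * Lattice polytopes in the plane *)

Section Polytopes.
Variable R : realType.
Local Notation plane := 'cV[R]_2.

Definition lpoint (x y : int) : 'cV[int]_2 := \col_(i < 2) [:: x; y]`_i.

Definition embed (v : 'cV[int]_2) : plane := map_mx intr v.

Definition conv_hull (s : seq 'cV[int]_2) : set plane :=
  [set x | exists w : 'I_(size s) -> R,
     [/\ forall i, 0 <= w i,
         \sum_i w i = 1 &
         x = \sum_i w i *: embed s`_i]].

Definition lattice_polytope (Q : set plane) : Prop :=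
  exists2 s : seq 'cV[int]_2, s != [::] & Q = conv_hull s.

(* [A] contains [d.+1] affinely independent points. *)
Definition aff_dim_ge (d : nat) (A : set plane) : Prop :=
  exists (x : plane) (D : 'M[R]_(2, d)),
    [/\ A x, forall j, A (x + col j D) & \rank D = d].

(* The affine dimension; [d < 3] loses nothing since [\rank D <= 2].  The
   empty set also gets dimension 0, but polytopes are nonempty. *)
Definition aff_dim (A : set plane) : nat :=
  \max_(d < 3 | `[< aff_dim_ge d A >]) d.

Definition lattice_polygon (P : set plane) : Prop :=
  lattice_polytope P /\ aff_dim P = 2%N.

Definition minkowski_sum (l : nat) (Qs : 'I_l -> set plane) : set plane :=
  [set \sum_i x i | x in [set x : 'I_l -> plane | forall i, Qs i (x i)]].

Definition minkowski_decomp (Q : set plane) (l : nat)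
    (Qs : 'I_l -> set plane) : Prop :=
  (forall i, lattice_polytope (Qs i) /\ (0 < aff_dim (Qs i))%N) /\
  Q = minkowski_sum Qs.

Definition is_max (S : set nat) (m : nat) : Prop :=
  S m /\ forall k, S k -> (k <= m)%N.

(* [l] is the Minkowski length of [Q]. *)
Definition minkowski_length (Q : set plane) (l : nat) : Prop :=
  if aff_dim Q == 0%N then l = 0%N
  else is_max [set k | exists Qs : 'I_k -> set plane, minkowski_decomp Q Qs] l.

(* [l] is the full Minkowski length of [P]. *)
Definition full_minkowski_length (P : set plane) (l : nat) : Prop :=
  is_max [set k | exists Q, [/\ lattice_polytope Q, Q `<=` P &
                                minkowski_length Q k]] l.

Definition maximal_decomp_in (P : set plane) (l : nat)
    (Qs : 'I_l -> set plane) : Prop :=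
  full_minkowski_length P l /\
  exists Q, [/\ lattice_polytope Q, Q `<=` P & minkowski_decomp Q Qs].

Definition T0 : set plane := conv_hull [:: lpoint 1 0; lpoint 0 1; lpoint 2 2].

(* [unitmx] over [int] is GL(2,Z). *)
Definition exceptional_triangle (T : set plane) : Prop :=
  exists (M : 'M[int]_2) (b : 'cV[int]_2),
    M \in unitmx /\ T = [set map_mx intr M *m x + embed b | x in T0].

Definition has_exceptional_maximal_decomp (P : set plane) : Prop :=
  exists (l : nat) (Qs : 'I_l -> set plane),
    maximal_decomp_in P Qs /\ exists i, exceptional_triangle (Qs i).

Definition lists_lattice_points (s : seq 'cV[int]_2) (P : set plane) : Prop :=
  uniq s /\ forall v, v \in s <-> P (embed v).

End Polytopes.

(** * Algorithms: structured programs for an integer random access machine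

    The machine has integer registers and an integer-addressed memory of
    integers.  The elementary operations are addition, subtraction,
    multiplication, comparisons, and the reading or writing of one constant,
    register or memory cell; each costs one unit whatever the size of the
    operands.  There is no division. *)

Inductive binop := OpAdd | OpSub | OpMul | OpEq | OpLe | OpLt.

Inductive expr :=
  | Cst of int
  | Reg of nat
  | Read of expr
  | Bin of binop & expr & expr.

Inductive cmd :=
  | Skip
  | Assign of nat & expr
  | Store of expr & expr        (* address, value *)
  | Seq of cmd & cmd
  | If of expr & cmd & cmd
  | While of expr & cmd.

Record state := State { regs : nat -> int; memory : int -> int }.

Definition eval_binop (o : binop) (x y : int) : int :=
  match o with
  | OpAdd => x + y
  | OpSub => x - y
  | OpMul => x * y
  | OpEq => if x == y then 1 else 0
  | OpLe => if x <= y then 1 else 0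
  | OpLt => if x < y then 1 else 0
  end.

Fixpoint eval (st : state) (e : expr) : int :=
  match e with
  | Cst z => z
  | Reg r => regs st r
  | Read a => memory st (eval st a)
  | Bin o e1 e2 => eval_binop o (eval st e1) (eval st e2)
  end.

(* The number of elementary operations performed by [eval _ e]. *)
Fixpoint cost (e : expr) : nat :=
  match e with
  | Cst _ | Reg _ => 1
  | Read a => (cost a).+1
  | Bin _ e1 e2 => (cost e1 + cost e2).+1
  end.

Definition set_reg (st : state) (r : nat) (z : int) : state :=
  State (fun r' => if r' == r then z else regs st r') (memory st).

Definition set_mem (st : state) (a z : int) : state :=
  State (regs st) (fun a' => if a' == a then z else memory st a').

(* [exec c st t st']: started in [st], the program [c] halts in [st'] after [t]
   elementary operations.  A test holds when its value is nonzero. *)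
Inductive exec : cmd -> state -> nat -> state -> Prop :=
  | ExecSkip st :
      exec Skip st 1 st
  | ExecAssign r e st :
      exec (Assign r e) st (cost e).+1 (set_reg st r (eval st e))
  | ExecStore a e st :
      exec (Store a e) st (cost a + cost e).+1
           (set_mem st (eval st a) (eval st e))
  | ExecSeq c1 c2 st st1 st2 t1 t2 :
      exec c1 st t1 st1 -> exec c2 st1 t2 st2 ->
      exec (Seq c1 c2) st (t1 + t2) st2
  | ExecIfTrue e c1 c2 st st' t :
      eval st e != 0 -> exec c1 st t st' ->
      exec (If e c1 c2) st (cost e + t).+1 st'
  | ExecIfFalse e c1 c2 st st' t :
      eval st e = 0 -> exec c2 st t st' ->
      exec (If e c1 c2) st (cost e + t).+1 st'
  | ExecWhileTrue e c st st1 st2 t1 t2 :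
      eval st e != 0 -> exec c st t1 st1 -> exec (While e c) st1 t2 st2 ->
      exec (While e c) st (cost e + t1 + t2).+1 st2
  | ExecWhileFalse e c st :
      eval st e = 0 ->
      exec (While e c) st (cost e).+1 st.

Lemma exec_deterministic c st t1 st1 t2 st2 :
  exec c st t1 st1 -> exec c st t2 st2 -> t1 = t2 /\ st1 = st2.
Proof.
move=> H; elim: H t2 st2 => {c st t1 st1} /=; intros;
  match goal with H : exec _ _ _ _ |- _ => inversion H; subst; clear H end;
  repeat match goal with
  | IH : forall _ _, exec ?c ?st _ _ -> _, H : exec ?c ?st _ _ |- _ =>
      destruct (IH _ _ H); clear H; subst
  | H0 : eval ?st ?e = 0, H1 : is_true (eval ?st ?e != 0) |- _ =>
      by rewrite H0 in H1
  end; by [].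
Qed.

(* The input [s] is presented with its length in register 0 and the coordinates
   of its [i]-th point in the cells [2 i] and [2 i + 1]; everything else is 0. *)
Definition input_state (s : seq 'cV[int]_2) : state :=
  State (fun r => if r == 0%N then (size s)%:Z else 0)
        (fun a => if a is Posz m then s`_(m./2) (inord (odd m)) 0 else 0).

Definition accepts (st : state) : Prop := regs st 0 = 1.

(* Main.v *)
(** A maximal Minkowski decomposition can be shrunk to one in which every
    summand is a lattice segment or the exceptional triangle, so that the
    problem is about zonotopes [x + [0, v_1] + .. + [0, v_l]] whose vertices are
    in [P], or, when the triangle occurs, in the intersection of three
    translates of [P].  If two different vectors [v], [w] of a longest such
    zonotope were congruent modulo 3, say [v = w + 3 u], then the segment from
    [w] to [v] in the parallelogram spanned by [v] and [w] would allow replacing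
    these two summands by three copies of [u].  Hence at most 9 different vectors
    occur, and a longest zonotope is described by boundedly many lattice points
    of [P] and multiplicities less than the number of lattice points.  The
    property is thus expressed by a formula with a fixed number of quantifiers,
    each ranging over [0, |s|), and nested loops evaluate such a formula. *)

Require Import Defs.
From mathcomp Require Import all_boot all_order all_algebra.
From mathcomp Require Import boolp classical_sets reals.
From mathcomp Require Import zify ring lra.

Set Implicit Arguments.
Unset Strict Implicit.
Unset Printing Implicit Defensive.

Import Order.TTheory GRing.Theory Num.Theory.
Local Open Scope ring_scope.

Local Notation point := 'cV[int]_2.

(** * Predicates decidable in polynomial time *)

Lemma eq_point (u v : point) : u 0 0 = v 0 0 -> u 1 0 = v 1 0 -> u = v.
Proof.
move=> h0 h1; apply/matrixP => i j; rewrite (ord1 j).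
by case: i => [[|[|//]]] hi; [move: h0|move: h1]; congr (u _ _ = v _ _);
  apply/val_inj.
Qed.

(* The variable [e_i] is kept in register [i + 2]; register 1 receives the truth
   values computed by the programs below. *)
Definition represents (s : seq point) (e : seq nat) (st : state) : Prop :=
  [/\ regs st 0 = (size s)%:Z,
      forall i, (i < size e)%N -> regs st i.+2 = (nth 0%N e i)%:Z &
      memory st = memory (input_state s)].

(** The expression is chosen before [s] and [e], so its cost is a constant. *)
Definition computes (n : nat) (f : seq point -> seq nat -> int) : Prop :=
  exists x, forall s e st, size e = n -> represents s e st -> eval st x = f s e.

(** Since [represents] holds again at the end, such programs can be run one after another; registers
    past the variables are scratch space. A nonempty list makes every power of [size s] positive, so
    that constant costs can be absorbed. *)
Definition decides (n : nat) (A : seq point -> seq nat -> Prop) : Prop :=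
  exists (c : cmd) (C k : nat), forall s e st,
    (0 < size s)%N -> size e = n -> represents s e st ->
    exists (t : nat) (st' : state),
      [/\ exec c st t st', (t <= C * size s ^ k)%N, represents s e st' &
          regs st' 1 = if `[< A s e >] then 1 else 0].

Lemma represents_set_reg s e st r z :
  represents s e st -> r = 1%N \/ r = (size e).+2 ->
  represents s e (set_reg st r z).
Proof.
move=> [h0 he hm] hr; split => //=.
  by case: hr => ->.
move=> i ile; rewrite ifN ?he//.
by case: hr => ->; lia.
Qed.

Lemma represents_rcons s e st i :
  represents s e st -> regs st (size e).+2 = i%:Z ->
  represents s (rcons e i) st.
Proof.
move=> [h0 he hm] hi; split => // j; rewrite size_rcons ltnS nth_rcons => jle.
by case: ltngtP jle => [/he //|//|->].
Qed.

Lemma represents_take s e st n : represents s e st -> represents s (take n e) st.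
Proof.
move=> [h0 he hm]; split => // i; rewrite size_take_min leq_min => /andP[lin lie].
by rewrite nth_take// he.
Qed.

Lemma computes_ext n f g :
  (forall s e, size e = n -> f s e = g s e) -> computes n f -> computes n g.
Proof. by move=> fg [x hx]; exists x => s e st h1 h2; rewrite (hx s e)// fg. Qed.

Lemma computes_cst n (z : int) : computes n (fun _ _ => z).
Proof. by exists (Cst z). Qed.

Lemma computes_var n i : (i < n)%N -> computes n (fun _ e => (nth 0%N e i)%:Z).
Proof. by move=> lin; exists (Reg i.+2) => s e st sz [_ he _] /=; rewrite he ?sz. Qed.

Lemma computes_coord n i (j : 'I_2) : (i < n)%N ->
  computes n (fun s e => s`_(nth 0%N e i) j 0).
Proof.
move=> lin; exists (Read (Bin OpAdd (Bin OpMul (Cst 2) (Reg i.+2)) (Cst j%:Z))).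
move=> s e st sz [_ he hm] /=; rewrite hm /= he ?sz//.
set k := nth 0%N e i.
(* Half and parity of this address recover the point and the coordinate. *)
rewrite (_ : 2 * k%:Z + j%:Z = (k.*2 + j)%:Z); last by lia.
have -> : (k.*2 + j)./2 = k by case: j => [[|[|//]]] /= _; lia.
congr (s`_k _ 0); apply/val_inj; rewrite /= inordK.
  by case: j => [[|[|//]]] /= _; lia.
by case: (odd _).
Qed.

Lemma computes_bin n f g (o : binop) : computes n f -> computes n g ->
  computes n (fun s e => eval_binop o (f s e) (g s e)).
Proof.
move=> [x hx] [y hy]; exists (Bin o x y) => s e st sz r /=.
by rewrite (hx s e)// (hy s e).
Qed.

Lemma computes_sum n K (f : nat -> seq point -> seq nat -> int) :
  (forall k, (k < K)%N -> computes n (f k)) ->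
  computes n (fun s e => \sum_(k < K) f k s e).
Proof.
elim: K => [|K IH] h.
  by apply: computes_ext (computes_cst n 0) => s e _; rewrite big_ord0.
apply: computes_ext (computes_bin OpAdd (IH _) (h K _)) => //.
  by move=> s e _; rewrite big_ord_recr.
by move=> k kK; apply: h; apply: ltnW.
Qed.

Lemma computes_take n m f :
  (n <= m)%N -> computes n f -> computes m (fun s e => f s (take n e)).
Proof.
move=> nm [x hx]; exists x => s e st sz /(represents_take n) r; apply: hx => //.
by rewrite size_takel ?sz.
Qed.

Lemma decides_ext n A B :
  (forall s e, size e = n -> A s e <-> B s e) -> decides n A -> decides n B.
Proof.
move=> AB [c [C [k h]]]; exists c, C, k => s e st s0 sz r.
have [t [st' [h1 h2 h3 h4]]] := h s e st s0 sz r.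
by exists t, st'; split => //; rewrite h4 (asbool_equiv_eq (AB s e sz)).
Qed.

Lemma decides_assign n (x : expr) (A : seq point -> seq nat -> Prop) :
  (forall s e st, size e = n -> represents s e st ->
     eval st x = if `[< A s e >] then 1 else 0) -> decides n A.
Proof.
move=> hx; exists (Assign 1 x), (cost x).+1, 0%N => s e st s0 sz r.
exists (cost x).+1, (set_reg st 1 (eval st x)); split.
- exact: ExecAssign.
- by rewrite expn0 muln1.
- by apply: represents_set_reg => //; left.
- exact: hx.
Qed.

Lemma decides_eq n f g : computes n f -> computes n g ->
  decides n (fun s e => f s e = g s e).
Proof.
move=> cf cg; have [x hx] := computes_bin OpEq cf cg.
apply: (decides_assign (x := x)) => s e st sz r; rewrite (hx s e)//=.
by rewrite (asbool_equiv_eqP eqP (iff_refl _)).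
Qed.

Lemma decides_le n f g : computes n f -> computes n g ->
  decides n (fun s e => f s e <= g s e).
Proof.
move=> cf cg; have [x hx] := computes_bin OpLe cf cg.
by apply: (decides_assign (x := x)) => s e st sz r; rewrite (hx s e)//= asboolb.
Qed.

Lemma decides_not n A : decides n A -> decides n (fun s e => ~ A s e).
Proof.
move=> [c [C [k h]]].
exists (Seq c (Assign 1 (Bin OpEq (Reg 1) (Cst 0)))), (C + 4)%N, k.
move=> s e st s0 sz r; have [t [st' [h1 h2 h3 h4]]] := h s e st s0 sz r.
exists (t + 4)%N; eexists; split.
- by apply: ExecSeq h1 _; apply: ExecAssign.
- by have := expn_gt0 (size s) k; rewrite s0 /=; nia.
- by apply: represents_set_reg => //; left.
- by rewrite /= h4 asbool_neg; case: asboolP.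
Qed.

(** The exponent [k1 + k2] dominates both, and positivity of [N] lets this power absorb the constant
    [c] too. *)
Lemma leq_add_expn (N C1 k1 C2 k2 c t1 t2 : nat) : (0 < N)%N ->
  (t1 <= C1 * N ^ k1)%N -> (t2 <= C2 * N ^ k2)%N ->
  (t1 + t2 + c <= (C1 + C2 + c) * N ^ (k1 + k2))%N.
Proof.
move=> N0 h1 h2.
have e1 : (N ^ k1 <= N ^ (k1 + k2))%N by apply: leq_pexp2l => //; lia.
have e2 : (N ^ k2 <= N ^ (k1 + k2))%N by apply: leq_pexp2l => //; lia.
have e3 : (0 < N ^ (k1 + k2))%N by rewrite expn_gt0 N0.
nia.
Qed.

Lemma decides_and n A B : decides n A -> decides n B ->
  decides n (fun s e => A s e /\ B s e).
Proof.
move=> [c1 [C1 [k1 hA]]] [c2 [C2 [k2 hB]]].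
exists (Seq c1 (If (Reg 1) c2 Skip)), (C1 + C2 + 3)%N, (k1 + k2)%N.
move=> s e st s0 sz r; have [t1 [st1 [h1 h2 h3 h4]]] := hA s e st s0 sz r.
have [t2 [st2 [h5 h6 h7 h8]]] := hB s e st1 s0 sz h3.
have bound := leq_add_expn 3 s0 h2 h6.
rewrite asbool_and; case: asboolP h4 => hAs h4 /=.
  exists (t1 + (1 + t2).+1)%N, st2; split => //.
  - apply: ExecSeq h1 _; apply: ExecIfTrue => //.
    by rewrite /= h4.
  - by apply: leq_trans bound; lia.
(* Register 1 already holds 0, which is the value of the conjunction. *)
exists (t1 + (1 + 1).+1)%N, st1; split => //.
- by apply: ExecSeq h1 _; apply: ExecIfFalse => //; apply: ExecSkip.
- by apply: leq_trans bound; lia.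
Qed.

(** A linear search that stops at the first witness, with the candidate in the first register after
    the variables; the degree of the time bound grows by one. *)
Lemma decides_ex n (A : seq point -> seq nat -> nat -> Prop) :
  decides n.+1 (fun s e => A s (take n e) (nth 0%N e n)) ->
  decides n (fun s e => exists2 i, (i < size s)%N & A s e i).
Proof.
move=> [c [C [k h]]].
(* The product is a conjunction: candidates remain and no witness has been found. *)
set test := Bin OpMul (Bin OpLt (Reg n.+2) (Reg 0)) (Bin OpEq (Reg 1) (Cst 0)).
set body := Seq c (Assign n.+2 (Bin OpAdd (Reg n.+2) (Cst 1))).
(* Induction on the number [d] of candidates left, the next one being [i]; register 1 is 0 as long
   as no witness has been met. *)
have loop s e st d i : (0 < size s)%N -> size e = n -> represents s e st ->
    regs st n.+2 = i%:Z -> regs st 1 = 0 -> (i + d = size s)%N ->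
  exists (t : nat) (st' : state),
    [/\ exec (While test body) st t st',
        (t <= d * (C * size s ^ k + 20) + 20)%N, represents s e st' &
        regs st' 1 = if `[< exists2 j, (i <= j < size s)%N & A s e j >]
                     then 1 else 0].
  move=> s0 sz; elim: d st i => [|d IH] st i r ri r1.
    rewrite addn0 => iN; exists 8%N, st; split => //.
      apply: ExecWhileFalse; rewrite /= ri r1 eqxx mulr1.
      by case: r => -> _ _; rewrite -iN ltxx.
    case: asboolP => // -[j]; rewrite iN; lia.
  move=> iN.
  have r0 : regs st 0 = (size s)%:Z by case: r.
  have re : represents s (rcons e i) st by apply: represents_rcons; rewrite ?sz.
  have [t1 [st1 [h1 h2 h3 h4]]] :=
    h s (rcons e i) st s0 (etrans (size_rcons _ _) (congr1 S sz)) re.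
  have r3 : represents s e st1.
    by have := represents_take n h3; rewrite -cats1 -sz take_size_cat.
  have r4 : regs st1 n.+2 = i%:Z.
    by case: h3 => _ /(_ n); rewrite size_rcons sz nth_rcons sz ltnn eqxx => ->.
  rewrite -cats1 -{1 2}sz take_size_cat// nth_cat ltnn subnn /= in h4.
  pose st2 := set_reg st1 n.+2 (i.+1)%:Z.
  have E2 : exec body st (t1 + 4) st2.
    apply: ExecSeq h1 _; rewrite /st2.
    rewrite (_ : i.+1%:Z = eval st1 (Bin OpAdd (Reg n.+2) (Cst 1))).
      exact: ExecAssign.
    by rewrite /= r4; lia.
  have rep2 : represents s e st2.
    by apply: represents_set_reg => //; right; rewrite sz.
  have tst : eval st test != 0.
    by rewrite /= ri r0 r1 eqxx mulr1 ltz_nat ifT//; lia.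
  have ri2 : regs st2 n.+2 = i.+1%:Z by rewrite /= eqxx.
  have r12 : regs st2 1 = if `[< A s e i >] then 1 else 0 by rewrite /= h4.
  (* If [i] is a witness, register 1 is now 1 and the next test ends the loop. *)
  case: asboolP r12 => hA r12.
    exists (7 + (t1 + 4) + 8).+1, st2; split => //.
    - apply: ExecWhileTrue E2 _ => //; apply: (@ExecWhileFalse test).
      by rewrite /= h4 asboolT//= mulr0.
    - rewrite mulSn; nia.
    - rewrite r12 asboolT//; exists i => //; lia.
  have [|t3 [st3 [h5 h6 h7 h8]]] := IH st2 i.+1 rep2 ri2 r12; first by lia.
  exists (7 + (t1 + 4) + t3).+1, st3; split => //.
  - exact: ExecWhileTrue E2 h5.
  - rewrite mulSn; lia.
  - rewrite h8; congr (if _ then _ else _); apply: asbool_equiv_eq; split.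
      by move=> [j hj Aj]; exists j => //; lia.
    move=> [j hj Aj]; exists j => //.
    by case: (ltngtP i j) hj => // ij; case: hA; rewrite ij.
exists (Seq (Assign n.+2 (Cst 0)) (Seq (Assign 1 (Cst 0)) (While test body))).
exists (C + 50)%N, k.+1 => s e st s0 sz r.
pose st2 := set_reg (set_reg st n.+2 0) 1 0.
have rep2 : represents s e st2.
  by apply: represents_set_reg; [apply: represents_set_reg => //; right; rewrite sz|left].
have ri : regs st2 n.+2 = 0%:Z by rewrite /= eqxx.
have [t [st' [h1 h2 h3 h4]]] :=
  loop s e st2 (size s) 0%N s0 sz rep2 ri erefl (add0n _).
exists (2 + (2 + t))%N, st'; split => //.
- apply: ExecSeq (ExecAssign _ (Cst 0) _) _.
  exact: ExecSeq (ExecAssign _ (Cst 0) _) h1.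
- rewrite expnS; have := expn_gt0 (size s) k; rewrite s0 /= => ?.
  apply: (@leq_trans (size s * (C * size s ^ k + 20) + 24)); first lia.
  have : (size s <= size s * size s ^ k)%N by rewrite leq_pmulr.
  nia.
Qed.

(** * Quantifiers over tuples of indices *)

Definition indices (s : seq point) (n : nat) (f : seq nat) : Prop :=
  size f = n /\ all (fun i => (i < size s)%N) f.

(** The last entry is the innermost variable and is searched by [decides_ex]; the induction
    hypothesis treats the other entries. *)
Lemma decides_exists_indices n M (A : seq point -> seq nat -> seq nat -> Prop) :
  decides (n + M) (fun s e => A s (take n e) (drop n e)) ->
  decides n (fun s e => exists f, indices s M f /\ A s e f).
Proof.
elim: M A => [|M IH] A.
  rewrite addn0; apply: decides_ext => s e sz.
  rewrite take_oversize ?drop_oversize ?sz//; split; first by exists [::].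
  by move=> [f [[/size0nil ->]]].
rewrite addnS => hA.
pose B s e f := exists2 i, (i < size s)%N & A s e (rcons f i).
have /IH : decides (n + M) (fun s e => B s (take n e) (drop n e)).
  apply: decides_ex; apply: decides_ext hA => s e sz.
  rewrite take_takel ?leq_addr//.
  suff -> : rcons (drop n (take (n + M) e)) (nth 0%N e (n + M)) = drop n e by [].
  rewrite -drop_rcons ?size_takel ?sz ?leqnSn ?leq_addr//.
  by rewrite -take_nth ?sz// -sz take_size.
apply: decides_ext => s e sz; split.
  move=> [f [[sf af] [i iN hAi]]]; exists (rcons f i).
  by rewrite /indices size_rcons sf all_rcons iN af.
move=> [f []]; case/lastP: f => [[]//|f i].
rewrite /indices size_rcons all_rcons => -[[sf] /andP[iN af]] hAi.
by exists f; split => //; exists i.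
Qed.

Lemma decides_imp n A B : decides n A -> decides n B ->
  decides n (fun s e => A s e -> B s e).
Proof.
move=> dA dB.
apply: decides_ext (decides_not (decides_and dA (decides_not dB))) => s e _.
split=> [h hA|h [hA]]; last by apply; apply: h.
by apply: contrapT => hB; apply: h.
Qed.

(** As [K] is a constant, the quantifier is unrolled into a conjunction, and each [A k] may have a
    program of its own. *)
Lemma decides_forall_lt n K (A : nat -> seq point -> seq nat -> Prop) :
  (forall k, (k < K)%N -> decides n (A k)) ->
  decides n (fun s e => forall k, (k < K)%N -> A k s e).
Proof.
elim: K => [|K IH] h.
  by apply: decides_ext (decides_eq (computes_cst n 0) (computes_cst n 0)).
apply: decides_ext (decides_and (IH _) (h K (ltnSn _))) => [s e _|k kK].
  split=> [[hl hK] k|hl]; last by split=> [k kK|]; apply: hl; rewrite // ltnW.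
  by rewrite ltnS leq_eqVlt => /predU1P[->|/hl].
by apply: h; apply: ltnW.
Qed.

Lemma decides_forall_indices n M (A : seq point -> seq nat -> seq nat -> Prop) :
  decides (n + M) (fun s e => A s (take n e) (drop n e)) ->
  decides n (fun s e => forall f, indices s M f -> A s e f).
Proof.
move=> /decides_not hA.
have := decides_not (decides_exists_indices (A := fun s e f => ~ A s e f) hA).
apply: decides_ext => s e _; split=> [h f hf|h [f [hf]]]; last by apply; apply: h.
by apply: contrapT => hn; apply: h; exists f.
Qed.

(** A tuple stored in [M] consecutive variables. This hides the nested [take] and [drop] that
    successive quantifiers produce. *)
Definition block (n M : nat) (f : seq nat -> seq nat) : Prop :=
  exists2 o, (o + M <= n)%N & forall e k, (k < M)%N -> size e = n ->
    nth 0%N (f e) k = nth 0%N e (o + k).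

Lemma block_drop n M : block (n + M) M (drop n).
Proof. by exists n => // e k _ _; rewrite nth_drop. Qed.

Lemma block_take n m M f : (n <= m)%N -> block n M f -> block m M (fun e => f (take n e)).
Proof.
move=> nm [o on h]; exists o => [|e k kM se]; first exact: leq_trans nm.
rewrite h// ?size_takel ?se// nth_take//.
by apply: leq_trans on; rewrite ltn_add2l.
Qed.

Lemma computes_nth n M f k : block n M f -> (k < M)%N ->
  computes n (fun _ e => (nth 0%N (f e) k)%:Z).
Proof.
move=> [o on h] kM; have ok : (o + k < n)%N by lia.
by apply: computes_ext (computes_var ok) => s e se; rewrite h.
Qed.

Definition computes_point n (x : seq point -> seq nat -> point) :=
  forall j, computes n (fun s e => x s e j 0).

Lemma computes_point_nth n M f k : block n M f -> (k < M)%N ->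
  computes_point n (fun s e => s`_(nth 0%N (f e) k)).
Proof.
move=> [o on h] kM j; have ok : (o + k < n)%N by lia.
by apply: computes_ext (computes_coord j ok) => s e se; rewrite h.
Qed.

Lemma computes_point_take n m x : (n <= m)%N ->
  computes_point n x -> computes_point m (fun s e => x s (take n e)).
Proof. by move=> nm h j; exact: computes_take nm (h j). Qed.

Lemma computes_pointD n x y : computes_point n x -> computes_point n y ->
  computes_point n (fun s e => x s e + y s e).
Proof.
by move=> hx hy j; apply: computes_ext (computes_bin OpAdd (hx j) (hy j)) => s e _;
  rewrite mxE.
Qed.

Lemma computes_pointB n x y : computes_point n x -> computes_point n y ->
  computes_point n (fun s e => x s e - y s e).
Proof.
by move=> hx hy j; apply: computes_ext (computes_bin OpSub (hx j) (hy j)) => s e _;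
  rewrite !mxE.
Qed.

Lemma computes_pointMn n x (m : seq point -> seq nat -> nat) :
  computes_point n x -> computes n (fun s e => (m s e)%:Z) ->
  computes_point n (fun s e => x s e *+ m s e).
Proof.
move=> hx hm j; apply: computes_ext (computes_bin OpMul (hx j) hm) => s e _ /=.
by rewrite mulmxnE -mulr_natr natz.
Qed.

Lemma computes_point_sum n K (x : nat -> seq point -> seq nat -> point) :
  (forall k, (k < K)%N -> computes_point n (x k)) ->
  computes_point n (fun s e => \sum_(k < K) x k s e).
Proof.
move=> h j.
apply: computes_ext (computes_sum (f := fun k s e => x k s e j 0) (fun k kK => h k kK j)).
by move=> s e _; rewrite summxE.
Qed.

Lemma decides_eq_point n x y : computes_point n x -> computes_point n y ->
  decides n (fun s e => x s e = y s e).
Proof.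
move=> hx hy.
apply: decides_ext (decides_and (decides_eq (hx 0) (hy 0)) (decides_eq (hx 1) (hy 1))).
by move=> s e _; split=> [[]|->//]; apply: eq_point.
Qed.

Lemma decides_mem n x : computes_point n x -> decides n (fun s e => x s e \in s).
Proof.
move=> hx.
have h : decides n (fun s e => exists2 i, (i < size s)%N & s`_i = x s e).
  apply: decides_ex; apply: decides_eq_point.
    by move=> j; apply: computes_coord.
  exact: computes_point_take hx.
by apply: decides_ext h => s e _; split=> /(nthP 0).
Qed.

(** * Lattice zonotopes *)

(** All sums of [x] with a subfamily of [V] lie in [A]. These points span the zonotope with base
    point [x] and one segment for each vector of [V]. *)
Fixpoint zonotope_in (A : point -> Prop) (V : seq point) (x : point) : Prop :=
  if V is v :: V' then zonotope_in A V' x /\ zonotope_in A V' (x + v) else A x.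

Lemma zonotope_in_base A V x : zonotope_in A V x -> A x.
Proof. by elim: V => //= v V IH [/IH]. Qed.

Lemma zonotope_in_mono (A B : point -> Prop) V x :
  (forall y, A y -> B y) -> zonotope_in A V x -> zonotope_in B V x.
Proof. by move=> AB; elim: V x => [|v V IH] x /=; [exact: AB|move=> [/IH ? /IH]]. Qed.

Lemma zonotope_in_ext (A B : point -> Prop) V x :
  (forall y, A y <-> B y) -> zonotope_in A V x <-> zonotope_in B V x.
Proof. by move=> AB; split; apply: zonotope_in_mono => y /AB. Qed.

Lemma zonotope_in_and (A B : point -> Prop) V x :
  zonotope_in (fun y => A y /\ B y) V x <-> zonotope_in A V x /\ zonotope_in B V x.
Proof. by elim: V x => //= v V IH x; rewrite !IH; tauto. Qed.

Lemma zonotope_in_shift (A : point -> Prop) V x u :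
  zonotope_in (fun y => A (y + u)) V x <-> zonotope_in A V (x + u).
Proof. by elim: V x => //= v V IH x; rewrite !IH addrAC. Qed.

Lemma zonotope_in_cat (A : point -> Prop) U V x :
  zonotope_in A (U ++ V) x <-> zonotope_in (zonotope_in A V) U x.
Proof. by elim: U x => //= u U IH x; rewrite !IH. Qed.

Lemma zonotope_in_cons_cat (A : point -> Prop) v U V x :
  zonotope_in A (U ++ v :: V) x <-> zonotope_in A (v :: U ++ V) x.
Proof.
elim: U x => //= u U IH x; rewrite !IH /= [x + v + u]addrAC; tauto.
Qed.

Lemma zonotope_in_perm (A : point -> Prop) U V x :
  perm_eq U V -> zonotope_in A U x -> zonotope_in A V x.
Proof.
elim: U V x => [|u U IH] V x UV; first by move/perm_size/esym/size0nil: UV => ->.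
have : u \in V by rewrite -(perm_mem UV) mem_head.
move: UV => /[swap] /splitPr[V1 V2].
rewrite perm_sym perm_catC /= perm_cons perm_catC perm_sym => UV.
by rewrite zonotope_in_cons_cat /= => -[/(IH _ _ UV) ? /(IH _ _ UV)].
Qed.

Lemma zonotope_in_mem (A : point -> Prop) V x v :
  v \in V -> zonotope_in A V x -> A (x + v).
Proof.
move=> /perm_to_rem /zonotope_in_perm /[apply] /= -[_].
exact: zonotope_in_base.
Qed.

Lemma zonotope_in_filter (A : point -> Prop) (a : pred point) V x :
  zonotope_in A V x -> zonotope_in A (filter a V) x.
Proof.
by elim: V x => //= v V IH x [/IH h1 /IH h2]; case: (a v).
Qed.

Lemma zonotope_in_nseq (A : point -> Prop) m v x :
  zonotope_in A (nseq m v) x <-> forall j, (j <= m)%N -> A (x + v *+ j).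
Proof.
elim: m x => [|m IH] x /=.
  split=> [Ax [|//] _|/(_ 0%N erefl)]; by rewrite mulr0n addr0.
rewrite !IH; split=> [[h0 h1] [_|j jm]|h].
- exact: (h0 0%N).
- by rewrite mulrS addrA; apply: h1.
- split=> j jm; first by apply: h; apply: leqW.
  by rewrite -addrA -mulrS; apply: h.
Qed.

(** * Sets closed under centroids, and directions modulo 3 *)

(** A discrete trace of convexity: the centroid of a triangle with vertices in [A] belongs to [A]
    whenever it is a lattice point. Unlike membership in a convex region, this is stated on lattice
    points alone, and it passes to zonotopes and to intersections of translates. *)
Definition centroid_closed (A : point -> Prop) : Prop :=
  forall g a b, A (g + a) -> A (g + b) -> A (g - a - b) -> A g.

Lemma centroid_closed_zonotope_in A V :
  centroid_closed A -> centroid_closed (zonotope_in A V).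
Proof.
move=> cA; elim: V => //= v V IH g a b [h1 h2] [h3 h4] [h5 h6]; split.
  exact: IH h1 h3 h5.
by apply: (IH _ a b); rewrite ![g + v + _]addrAC// [_ + v - b]addrAC.
Qed.

(** The two points that trisect a segment are centroids of degenerate triangles in which one end of
    the segment is counted twice. *)
Lemma centroid_closed_third A y u :
  centroid_closed A -> A y -> A (y + u *+ 3) -> A (y + u) /\ A (y + u *+ 2).
Proof.
move=> cA h1 h2; split.
  by apply: (cA _ (- u) (- u)); rewrite ?addrK// !opprK -!addrA -mulr2n -mulrS.
have e : y + u *+ 2 + u = y + u *+ 3 by rewrite -addrA -mulrSr.
by apply: (cA _ u u); rewrite ?e// mulr2n addrA !addrK.
Qed.

(* The parallelogram spanned by [v] and [w] contains the segment from [w] to [v]. *)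
Lemma zonotope_in_third (A : point -> Prop) V x v w u :
  centroid_closed A -> v = w + u *+ 3 ->
  zonotope_in A [:: v, w & V] x -> zonotope_in A [:: u, u, u & V] (x + w).
Proof.
move=> /(@centroid_closed_zonotope_in _ V) cB -> /=; set B := zonotope_in A V.
(* Only the corners [x + w] and [x + v] are used; they differ by three times [u]. *)
rewrite addrA => -[[_ h1] [h2 _]]; have [h3 h4] := centroid_closed_third cB h1 h2.
move: h2 h4; rewrite !mulrS mulr0n addr0 !addrA => h2 h4.
by repeat split.
Qed.

(** A bound on the full Minkowski length in terms of segments: every summand of positive dimension
    contains a lattice segment, so counting segments is enough. *)
Definition zonotope_size_le (A : point -> Prop) (l : nat) : Prop :=
  forall x V, 0 \notin V -> zonotope_in A V x -> (size V <= l)%N.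

Definition residue3 (v : point) : 'I_3 * 'I_3 :=
  (inord (absz (modz (v 0 0) 3)), inord (absz (modz (v 1 0) 3))).

Lemma residue3P u v : residue3 u = residue3 v -> exists w, u = v + w *+ 3.
Proof.
have h a b : @inord 2 (absz (a %% 3)%Z) = inord (absz (b %% 3)%Z) ->
    a = b + ((a %/ 3)%Z - (b %/ 3)%Z) *+ 3.
  move=> /(congr1 val); rewrite /= !inordK; lia.
move=> [/h h0 /h h1].
exists (lpoint (divz (u 0 0) 3 - divz (v 0 0) 3) (divz (u 1 0) 3 - divz (v 1 0) 3)).
by apply: eq_point; rewrite !mulrS mulr0n !mxE /=; lia.
Qed.

(** Distinct directions lie in distinct classes among the nine modulo 3: two in the same class could
    be traded for three copies of a nonzero vector, exceeding the maximal size. The set [A] is left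
    general so that the bound also applies to [fits_triangle]. *)
Lemma maximal_zonotope_few_directions A V x :
  centroid_closed A -> zonotope_size_le A (size V) -> 0 \notin V ->
  zonotope_in A V x -> (size (undup V) <= 9)%N.
Proof.
move=> cA hmax V0 hV.
suff /card_uniqP : uniq (map residue3 (undup V)).
  by rewrite size_map => <-; apply: leq_trans (max_card _) _; rewrite card_prod !card_ord.
rewrite map_inj_in_uniq ?undup_uniq// => v w; rewrite !mem_undup => vV wV.
move=> /residue3P[u vwu]; apply/eqP; apply: contraT => vw.
have pV : perm_eq V [:: v, w & rem w (rem v V)].
  apply: perm_trans (perm_to_rem vV) _; rewrite perm_cons perm_to_rem//.
  by move: wV; rewrite (perm_mem (perm_to_rem vV)) inE eq_sym (negPf vw).
have /(zonotope_in_third cA vwu) hz := zonotope_in_perm pV hV.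
have /hmax : 0 \notin [:: u, u, u & rem w (rem v V)].
  move: V0; rewrite (perm_mem pV) !inE !negb_or => /and3P[_ _ ->].
  suff u0 : 0 != u by rewrite u0.
  by apply: contra vw => /eqP u0; rewrite vwu -u0 mul0rn addr0.
by move=> /(_ _ hz); rewrite (perm_size pV) /= ltnn.
Qed.

(** * Zonotopes given by directions and multiplicities *)

Definition repeat_vectors (K : nat) (v : nat -> point) (m : nat -> nat) :=
  flatten [seq nseq (m k) (v k) | k <- iota 0 K].

Lemma repeat_vectorsS K v m :
  repeat_vectors K.+1 v m = repeat_vectors K v m ++ nseq (m K) (v K).
Proof.
by rewrite /repeat_vectors -[in LHS](addn1 K) iotaD map_cat flatten_cat /= cats0.
Qed.

Lemma size_repeat_vectors K v m : size (repeat_vectors K v m) = (\sum_(k < K) m k)%N.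
Proof.
elim: K => [|K IH]; first by rewrite big_ord0.
by rewrite repeat_vectorsS size_cat IH size_nseq big_ord_recr.
Qed.

Lemma mem0_repeat_vectors K v m :
  (forall k, (k < K)%N -> v k = 0 -> m k = 0%N) -> 0 \notin repeat_vectors K v m.
Proof.
elim: K => [//|K IH] h; rewrite repeat_vectorsS mem_cat negb_or; apply/andP; split.
  by apply: IH => k kK; apply: h; apply: ltnW.
rewrite mem_nseq; apply/andP => -[mK /eqP vK].
by move: mK; rewrite (h K (ltnSn _) (esym vK)).
Qed.

(** A sum over a subfamily depends only on how many copies of each vector it takes. Thus [K]
    coefficients replace exponentially many subfamilies. *)
Lemma zonotope_in_repeat A K v m x :
  zonotope_in A (repeat_vectors K v m) x <->
  forall b, size b = K -> (forall k, (k < K)%N -> (nth 0%N b k <= m k)%N) ->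
    A (x + \sum_(k < K) v k *+ nth 0%N b k).
Proof.
elim: K A => [|K IH] A.
  split=> [Ax b _ _|/(_ [::] erefl)]; rewrite big_ord0 addr0//; exact.
rewrite repeat_vectorsS zonotope_in_cat IH; split=> h b.
  case/lastP: b => [//|b j]; rewrite size_rcons => -[sb] hb.
  have /zonotope_in_nseq/(_ j) : zonotope_in A (nseq (m K) (v K))
      (x + \sum_(k < K) v k *+ nth 0%N b k).
    by apply: h => // k kK; have := hb k (ltnW kK); rewrite nth_rcons sb kK.
  rewrite big_ord_recr /= addrA nth_rcons sb ltnn eqxx.
  have := hb K (ltnSn _); rewrite nth_rcons sb ltnn eqxx => jm /(_ jm).
  congr (A (_ + _ + _)); apply: eq_bigr => k _.
  by rewrite nth_rcons sb ltn_ord.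
move=> sb hb; apply/zonotope_in_nseq => j jm.
have := h (rcons b j); rewrite size_rcons sb big_ord_recr /=.
rewrite addrA nth_rcons sb ltnn eqxx => /(_ erefl) H.
have -> : \sum_(k < K) v k *+ nth 0%N b k = \sum_(k < K) v k *+ nth 0%N (rcons b j) k.
  by apply: eq_bigr => k _; rewrite nth_rcons sb ltn_ord.
apply: H => k; rewrite nth_rcons sb ltnS leq_eqVlt => /predU1P[->|kK].
  by rewrite ltnn eqxx.
by rewrite kK hb.
Qed.

Lemma perm_repeat_vectors V K : 0 \notin V -> (size (undup V) <= K)%N ->
  perm_eq (repeat_vectors K (nth 0 (undup V))
             (fun k => count_mem (nth 0 (undup V) k) V)) V.
Proof.
move=> V0; elim: K => [|K IH].
  by rewrite leqn0 size_eq0 => /eqP /undup_nil ->.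
rewrite leq_eqVlt => /predU1P[<-|]; last first.
  (* Past the distinct vectors [nth] returns 0, whose multiplicity is 0 because 0 is not in [V]. *)
  rewrite ltnS => sK; rewrite repeat_vectorsS nth_default//.
  by rewrite (count_memPn V0) cats0; apply: IH.
rewrite /repeat_vectors.
rewrite (_ : map _ _ = [seq nseq (count_mem w V) w | w <- undup V]).
  exact: perm_count_undup.
by rewrite -[in RHS](mkseq_nth 0 (undup V)) -map_comp.
Qed.

(** If [v] occurs [m] times, the [m + 1] points from [x] to [x + v *+ m] are distinct elements of
    [s]. Hence multiplicities can be stored as indices into [s]. *)
Lemma count_lt_of_zonotope_in (s V : seq point) x v : v != 0 ->
  zonotope_in (fun y => y \in s) V x -> (count_mem v V < size s)%N.
Proof.
move=> v0 /(zonotope_in_filter (pred1 v)).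
have /all_pred1P -> := filter_all (pred1 v) V; rewrite size_filter.
set m := count _ _ => /zonotope_in_nseq h.
rewrite -(size_iota 0 m.+1) -(size_map (fun j => x + v *+ j)).
apply: uniq_leq_size => [|y /mapP[j]]; last first.
  by rewrite mem_iota ltnS => /h ? ->.
rewrite map_inj_uniq ?iota_uniq// => i j /addrI /matrixP vij.
have /existsP[k vk] : [exists k, v k 0 != 0].
  apply: contraNT v0 => /existsPn h0; apply/eqP/matrixP => k l.
  by rewrite (ord1 l) mxE; apply/eqP/negPn; exact: h0.
by have := vij k 0; rewrite !mulmxnE => /(mulrIn vk).
Qed.

(** The points [x + v] show that there are at most [size s] directions, each of multiplicity less
    than [size s]. This crude bound is what makes maxima exist. *)
Lemma zonotope_size_bounded (s : seq point) :
  zonotope_size_le (fun y => y \in s) (size s * size s).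
Proof.
move=> x V V0 hV.
rewrite -(perm_size (perm_repeat_vectors V0 (leqnn _))) size_repeat_vectors.
apply: (@leq_trans (\sum_(k < size (undup V)) size s)).
  apply: leq_sum => k _; apply/ltnW/(count_lt_of_zonotope_in _ hV).
  by apply: contraNneq V0 => <-; rewrite -mem_undup mem_nth.
rewrite sum_nat_const card_ord leq_mul2r; apply/orP; right.
rewrite -(size_map (fun v => x + v)); apply: uniq_leq_size.
  by rewrite map_inj_uniq ?undup_uniq// => v w /addrI.
move=> y /mapP[v]; rewrite mem_undup => vV ->.
exact: (zonotope_in_mem vV hV).
Qed.

Lemma bounded_is_max (S : set nat) n B : S n -> (forall k, S k -> (k <= B)%N) ->
  exists m, is_max S m.
Proof.
move=> Sn hB.
have Sex : exists n, `[< S n >] by exists n; apply/asboolP.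
have Sb k : `[< S k >] -> (k <= B)%N by move=> /asboolP /hB.
case: (ex_maxnP Sex Sb) => m /asboolP Sm mmax; exists m; split=> // k Sk.
by apply: mmax; apply/asboolP.
Qed.

(** * An exceptional triangle together with segments *)

Definition cross (a b : point) : int := a 0 0 * b 1 0 - a 1 0 * b 0 0.

(* Up to lattice translations, the exceptional triangles are the triangles with
   vertices [a], [b], [- a - b] with [cross a b = 1 \/ cross a b = -1]. *)
Definition fits_triangle (A : point -> Prop) (a b y : point) : Prop :=
  [/\ A (y + a), A (y + b) & A (y - a - b)].

(** Here [l] counts the segments only; the triangle, with centroid [g], is one more summand, so
    maximality is expressed with [l.+1]. *)
Definition exceptional_zonotope (A : point -> Prop) (l : nat) : Prop :=
  exists (g a b : point) (V : seq point),
    [/\ cross a b ^+ 2 = 1, 0 \notin V, zonotope_in (fits_triangle A a b) V g,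
        size V = l & zonotope_size_le A l.+1].

Lemma centroid_closed_fits A a b :
  centroid_closed A -> centroid_closed (fits_triangle A a b).
Proof.
move=> cA g c d [h1 h2 h3] [h4 h5 h6] [h7 h8 h9]; split; apply: (cA _ c d).
1,2,4,5: by rewrite addrAC.
1,2: by rewrite (addrAC g) (addrAC (g - c)).
1,2: by rewrite (addrAC (g - a)) (addrAC g).
by rewrite (addrAC (g - a)) (addrAC g) (addrAC (g - c - a)) (addrAC (g - c)).
Qed.

Lemma zonotope_in_fits A a b V x : zonotope_in (fits_triangle A a b) V x <->
  [/\ zonotope_in A V (x + a), zonotope_in A V (x + b) & zonotope_in A V (x - a - b)].
Proof.
rewrite (zonotope_in_ext (B := fun y => A (y + a) /\ (A (y + b) /\ A (y + (- a - b))))).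
  by rewrite !zonotope_in_and !zonotope_in_shift addrA; split=> [[? []]|[]].
by move=> y; rewrite /fits_triangle addrA; split=> [[]|[? []]].
Qed.

(** The triangle can be replaced by its edge from [a] to [b]: adding the vector [b - a] to [V] gives
    a zonotope in [A] based at [x + a]. The edge is not zero because the cross product is not. *)
Lemma zonotope_size_le_fits A a b l : cross a b ^+ 2 = 1 ->
  zonotope_size_le A l.+1 -> zonotope_size_le (fits_triangle A a b) l.
Proof.
move=> ab hl x V V0 /zonotope_in_fits[h1 h2 h3].
suff /hl : 0 \notin b - a :: V.
  by move=> /(_ (x + a)) /= H; rewrite -ltnS; apply: H; rewrite -addrA [a + _]addrC subrK.
rewrite inE negb_or V0 andbT eq_sym subr_eq0.
by apply: contra_eq_neq ab => ->; rewrite /cross mulrC subrr expr0n.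
Qed.

(** * Encoding by indices into the list of points *)

Definition difference (s : seq point) (q : nat) (p : seq nat) (k : nat) : point :=
  s`_(nth 0%N p k) - s`_q.

(** The bound [size s] on the entries of [b] makes this a quantifier over indices; it follows from
    the bound by [m] when [m] itself consists of indices. *)
Definition sums_in (s : seq point) (q : nat) (p m : seq nat) (x : point) : Prop :=
  forall b, [/\ size b = 9, all (fun i => (i < size s)%N) b &
                forall k, (k < 9)%N -> (nth 0%N b k)%:Z <= (nth 0%N m k)%:Z] ->
    x + \sum_(k < 9) difference s q p k *+ nth 0%N b k \in s.

Definition step_count (m : seq nat) : int := \sum_(k < 9) (nth 0%N m k)%:Z.

Definition steps_nonzero (s : seq point) (q : nat) (p m : seq nat) : Prop :=
  forall k, (k < 9)%N -> difference s q p k = 0 -> (nth 0%N m k)%:Z = 0.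

Definition step_count_le (s : seq point) (l : int) : Prop :=
  forall p m h, indices s 9 p -> indices s 9 m -> indices s 1 h ->
    steps_nonzero s (nth 0%N h 0) p m -> sums_in s (nth 0%N h 0) p m s`_(nth 0%N h 0) ->
    step_count m <= l.

(** The points [i], [j], [g] stand for two vertices of the triangle and its centroid. Directions are
    measured from the vertex [i], from which each of them leads to a point of [s], and the triangle
    accounts for the added 1. *)
Definition exceptional_search (s : seq point) : Prop :=
  exists p m h, [/\ indices s 9 p, indices s 9 m, indices s 3 h &
   [/\ let: (i, j, g) := (s`_(nth 0%N h 0), s`_(nth 0%N h 1), s`_(nth 0%N h 2)) in
      [/\ cross (i - g) (j - g) ^+ 2 = 1,
          sums_in s (nth 0%N h 0) p m i,
          sums_in s (nth 0%N h 0) p m j &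
          sums_in s (nth 0%N h 0) p m (g - (i - g) - (j - g))],
      steps_nonzero s (nth 0%N h 0) p m & step_count_le s (step_count m + 1)]].

Lemma sums_inE s q p m x : indices s 9 m ->
  sums_in s q p m x <->
  zonotope_in (fun y => y \in s) (repeat_vectors 9 (difference s q p) (nth 0%N m)) x.
Proof.
move=> [sm am]; rewrite zonotope_in_repeat; split=> h b.
  move=> sb hb; apply: h; split=> //.
  apply/(all_nthP 0%N) => k; rewrite sb => k9.
  by apply: leq_ltn_trans (hb k k9) _; apply: (all_nthP 0%N am); rewrite sm.
by move=> [sb _ hb]; apply: h => // k /hb.
Qed.

Lemma step_countE m (v : nat -> point) :
  step_count m = (size (repeat_vectors 9 v (nth 0%N m)))%:Z.
Proof.
rewrite size_repeat_vectors /step_count -natz natr_sum.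
by apply: eq_bigr => k _; rewrite natz.
Qed.

Lemma steps_nonzeroE s q p m : steps_nonzero s q p m <->
  0 \notin repeat_vectors 9 (difference s q p) (nth 0%N m).
Proof.
split=> [h|].
  by apply: mem0_repeat_vectors => k k9 /(h k k9) [].
rewrite /repeat_vectors => h k k9 d0; congr Posz; apply/eqP.
apply: contraNT h => mk; apply/flatten_mapP; exists k; first by rewrite mem_iota.
by rewrite mem_nseq lt0n mk d0 /=.
Qed.

(* A zonotope with few distinct directions is encoded by the points reached
   from [x] along these directions and by their multiplicities. *)
Lemma encode_zonotope (s V : seq point) x :
  0 \notin V -> (size (undup V) <= 9)%N -> zonotope_in (fun y => y \in s) V x ->
  exists p m, [/\ indices s 9 p, indices s 9 m &
    perm_eq (repeat_vectors 9 (difference s (index x s) p) (nth 0%N m)) V].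
Proof.
move=> V0 V9 hV; have xs := zonotope_in_base hV.
pose v := nth 0 (undup V).
(* For [k] past the distinct vectors, [v k] is 0 and the point is [x] itself. *)
have xv k : x + v k \in s.
  case: (ltnP k (size (undup V))) => [|kV]; last by rewrite /v nth_default ?addr0.
  by move=> /(mem_nth 0); rewrite mem_undup => /zonotope_in_mem /(_ hV).
have s0 : (0 < size s)%N by case: (s) xs.
exists (mkseq (fun k => index (x + v k) s) 9), (mkseq (fun k => count_mem (v k) V) 9).
split.
- by split; rewrite ?size_mkseq//; apply/allP => _ /mapP[k _ ->]; rewrite index_mem.
- split; rewrite ?size_mkseq//; apply/allP => _ /mapP[k _ ->].
  have [->|v0] := eqVneq (v k) 0; first by rewrite (count_memPn V0).
  exact: count_lt_of_zonotope_in hV.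
- apply: etrans (perm_repeat_vectors V0 V9); congr perm_eq.
  congr flatten; apply/eq_in_map => k; rewrite mem_iota => /= k9.
  by rewrite /difference !nth_mkseq// !nth_index// [x + _]addrC addrK.
Qed.

(** The encoded statement sees only zonotopes with at most nine directions. It still bounds all of
    them, because a longest zonotope exists and has at most nine directions. *)
Lemma step_count_leE s l : centroid_closed (fun y => y \in s) ->
  step_count_le s l%:Z <-> zonotope_size_le (fun y => y \in s) l.
Proof.
move=> ts; split=> [h|h p m q hp hm _ /steps_nonzeroE h0 hz]; last first.
  rewrite (step_countE _ (difference s (nth 0%N q 0) p)).
  exact: h h0 ((sums_inE _ _ _ hm).1 hz).
move=> x V V0 hV.
pose S n := exists x V,
  [/\ 0 \notin V, zonotope_in (fun y => y \in s) V x & size V = n].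
have [||n [[x' [V' [V'0 hV' sV']]] nmax]] :=
  @bounded_is_max S (size V) (size s * size s).
- by exists x, V.
- by move=> k [y [W [W0 hW <-]]]; apply: zonotope_size_bounded hW.
apply: (@leq_trans n); first by apply: nmax; exists x, V.
have few := maximal_zonotope_few_directions ts _ V'0 hV'.
have {few} /encode_zonotope -/(_ _ _ V'0 hV')[p [m [hp hm pV]]] :
    (size (undup V') <= 9)%N.
  by apply: few => y W W0 hW; rewrite sV'; apply: nmax; exists y, W.
have x's := zonotope_in_base hV'.
have := h p m [:: index x' s] hp hm.
rewrite /indices /= index_mem x's => /(_ (conj erefl erefl)).
rewrite steps_nonzeroE (perm_mem pV) V'0 => /(_ isT); rewrite sums_inE// nth_index//.
rewrite perm_sym in pV.
rewrite (step_countE _ (difference s (index x' s) p)) -(perm_size pV) sV'; apply.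
exact: zonotope_in_perm pV hV'.
Qed.

(** For the encoding, the bound of nine directions is applied to the intersection of three
    translates given by [fits_triangle], where [V] is of maximal size. *)
Lemma exceptional_searchE s : centroid_closed (fun y => y \in s) ->
  exceptional_search s <-> exists l, exceptional_zonotope (fun y => y \in s) l.
Proof.
move=> ts; split.
  move=> [p [m [h [hp hm _ [[hc h1 h2 h3] h0 hl]]]]].
  set V := repeat_vectors 9 (difference s (nth 0%N h 0) p) (nth 0%N m).
  exists (size V), s`_(nth 0%N h 2), (s`_(nth 0%N h 0) - s`_(nth 0%N h 2)),
    (s`_(nth 0%N h 1) - s`_(nth 0%N h 2)), V; split => //.
  - exact/steps_nonzeroE.
  - apply/zonotope_in_fits; split; last exact/sums_inE.
    + by rewrite addrC subrK; apply/sums_inE.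
    + by rewrite addrC subrK; apply/sums_inE.
  - by apply/step_count_leE => //; rewrite -addn1 PoszD -step_countE.
move=> [l [g [a [b [V [hc V0 hV sV hl]]]]]].
have V9 : (size (undup V) <= 9)%N.
  apply: maximal_zonotope_few_directions (centroid_closed_fits ts) _ V0 hV.
  by apply: zonotope_size_le_fits; rewrite ?sV.
have [h1 h2 h3] := (zonotope_in_fits _ _ _ _ _).1 hV.
have [p [m [hp hm pV]]] := encode_zonotope V0 V9 h1.
have [ga gb gab] := zonotope_in_base hV.
(* The centroid has an index because the three vertices belong to [s]. *)
have gs : g \in s by apply: (ts g a b).
exists p, m, [:: index (g + a) s; index (g + b) s; index g s]; split=> //.
  by rewrite /indices /= !index_mem ga gb gs.
have sz := perm_size pV; rewrite perm_sym in pV.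
split; rewrite /= ?nth_index//.
- have addKr c : g + c - g = c by rewrite addrC addKr.
  by rewrite !addKr; split=> //; apply/sums_inE => //; apply: zonotope_in_perm pV _.
- by apply/steps_nonzeroE; rewrite -(perm_mem pV).
- rewrite (step_countE _ (difference s (index (g + a) s) p)) sz sV -PoszD addn1.
  exact/step_count_leE.
Qed.

(** * The search for an exceptional zonotope *)

Section Encoded.
Variables (n : nat) (p m : seq nat -> seq nat) (h : seq nat -> seq nat) (M : nat).
Hypotheses (bp : block n 9 p) (bm : block n 9 m) (bh : block n M.+1 h).

Lemma computes_difference k : (k < 9)%N ->
  computes_point n (fun s e => difference s (nth 0%N (h e) 0) (p e) k).
Proof.
by move=> k9; apply: computes_pointB; [exact: computes_point_nth bp _|
  exact: computes_point_nth bh _].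
Qed.

Lemma decides_steps_nonzero :
  decides n (fun s e => steps_nonzero s (nth 0%N (h e) 0) (p e) (m e)).
Proof.
apply: decides_forall_lt => k k9; apply: decides_imp.
  apply: (@decides_eq_point _ _ (fun _ _ => 0)); first exact: computes_difference.
  by move=> j; apply: computes_ext (computes_cst n 0) => s e _; rewrite mxE.
apply: decides_eq (computes_cst n 0); exact: computes_nth bm _.
Qed.

Lemma computes_step_count : computes n (fun s e => step_count (m e)).
Proof.
apply: (computes_sum (f := fun k s e => (nth 0%N (m e) k)%:Z)) => k k9.
exact: computes_nth bm k9.
Qed.

End Encoded.

Lemma decides_sums_in n M p m h x :
  block n 9 p -> block n 9 m -> block n M.+1 h -> computes_point n x ->
  decides n (fun s e => sums_in s (nth 0%N (h e) 0) (p e) (m e) (x s e)).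
Proof.
move=> bp bm bh hx.
have n9 : (n <= n + 9)%N by rewrite leq_addr.
pose B s e b := (forall k, (k < 9)%N -> (nth 0%N b k)%:Z <= (nth 0%N (m e) k)%:Z) ->
  x s e + \sum_(k < 9) difference s (nth 0%N (h e) 0) (p e) k *+ nth 0%N b k \in s.
have : decides n (fun s e => forall b, indices s 9 b -> B s e b).
  apply: decides_forall_indices; apply: decides_imp.
    apply: decides_forall_lt => k k9; apply: decides_le.
      exact: computes_nth (block_drop n 9) k9.
    exact: (computes_nth (block_take n9 bm) k9).
  apply: decides_mem; apply: computes_pointD; first exact: computes_point_take hx.
  apply: (computes_point_sum (x := fun k s e => difference s (nth 0%N (h (take n e)) 0)
    (p (take n e)) k *+ nth 0%N (drop n e) k)) => k k9.
  apply: computes_pointMn; last exact: computes_nth (block_drop n 9) k9.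
  exact: (computes_difference (block_take n9 bp) (block_take n9 bh) k9).
apply: decides_ext => s e _; split=> H b; first by case=> *; apply: H.
by case=> ? ? ?; apply: H.
Qed.

Lemma decides_step_count_le n l : computes n (fun s e => l s e) ->
  decides n (fun s e => step_count_le s (l s e)).
Proof.
move=> hl.
have h1 : (n <= n + 9)%N by rewrite leq_addr.
have h2 : (n + 9 <= n + 9 + 9)%N by rewrite leq_addr.
have h3 : (n + 9 + 9 <= n + 9 + 9 + 1)%N by rewrite leq_addr.
pose P s e p m h := steps_nonzero s (nth 0%N h 0) p m ->
  sums_in s (nth 0%N h 0) p m s`_(nth 0%N h 0) -> step_count m <= l s e.
have : decides n (fun s e => forall p, indices s 9 p ->
    forall m, indices s 9 m -> forall h, indices s 1 h -> P s e p m h).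
  do 3! apply: decides_forall_indices.
  have bp := block_take h3 (block_take h2 (block_drop n 9)).
  have bm := block_take h3 (block_drop (n + 9) 9).
  have bh := block_drop (n + 9 + 9) 1.
  apply: decides_imp; first exact: (decides_steps_nonzero bp bm bh).
  apply: decides_imp.
    exact: (decides_sums_in bp bm bh (computes_point_nth bh (isT : (0 < 1)%N))).
  apply: decides_le; first exact: computes_step_count bm.
  exact: computes_take h3 (computes_take h2 (computes_take h1 hl)).
apply: decides_ext => s e _; split=> H p.
  by move=> m h hp hm hh; exact: (H p hp m hm h hh).
by move=> hp m hm h hh ? ?; exact: (H p m h hp hm hh).
Qed.

Lemma decides_exceptional_search : decides 0 (fun s _ => exceptional_search s).
Proof.
pose P (s : seq point) (p m h : seq nat) := let: (i, j, g) :=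
    (s`_(nth 0%N h 0), s`_(nth 0%N h 1), s`_(nth 0%N h 2)) in
  cross (i - g) (j - g) ^+ 2 = 1 /\
  (sums_in s (nth 0%N h 0) p m i /\
  (sums_in s (nth 0%N h 0) p m j /\
  (sums_in s (nth 0%N h 0) p m (g - (i - g) - (j - g)) /\
  (steps_nonzero s (nth 0%N h 0) p m /\ step_count_le s (step_count m + 1))))).
have : decides 0 (fun s e => exists p, indices s 9 p /\
    exists m, indices s 9 m /\ exists h, indices s 3 h /\ P s p m h).
  do 3! apply: decides_exists_indices.
  (* The variables 0 to 8 hold [p], 9 to 17 hold [m], and 18 to 20 hold [h]. *)
  have bp := block_take (leq_addr 3 _) (block_take (leq_addr 9 _) (block_drop 0 9)).
  have bm := block_take (leq_addr 3 _) (block_drop (0 + 9) 9).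
  have bh := block_drop (0 + 9 + 9) 3.
  have ci := computes_point_nth bh (isT : (0 < 3)%N).
  have cj := computes_point_nth bh (isT : (1 < 3)%N).
  have cg := computes_point_nth bh (isT : (2 < 3)%N).
  have cig := computes_pointB ci cg; have cjg := computes_pointB cj cg.
  have ccr := computes_bin OpSub (computes_bin OpMul (cig 0) (cjg 1))
    (computes_bin OpMul (cig 1) (cjg 0)).
  have sums := fun x => decides_sums_in bp bm bh (x := x).
  apply: decides_and.
    exact: (decides_eq (computes_bin OpMul ccr ccr) (computes_cst _ 1)).
  apply: decides_and; first exact: (sums _ ci).
  apply: decides_and; first exact: (sums _ cj).
  apply: decides_and.
    exact: (sums _ (computes_pointB (computes_pointB cg cig) cjg)).
  apply: decides_and; first exact: decides_steps_nonzero bp bm bh.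
  apply: decides_step_count_le.
  exact: (computes_bin OpAdd (computes_step_count bm) (computes_cst _ 1)).
apply: decides_ext => s e _; split.
  move=> [p [hp [m [hm [h [hh [h1 [h2 [h3 [h4 [h5 h6]]]]]]]]]]].
  by exists p, m, h.
move=> [p [m [h [hp hm hh [[h1 h2 h3 h4] h5 h6]]]]].
by exists p; split=> //; exists m; split=> //; exists h.
Qed.

(** * Polytopes and zonotopes *)

Local Open Scope classical_set_scope.

Section ConvexHulls.
Variable R : realType.
Local Notation plane := 'cV[R]_2.
Implicit Types (C : set plane) (s : seq point).

Definition convex C : Prop := forall x y (t : R),
  C x -> C y -> 0 <= t <= 1 -> C (t *: x + (1 - t) *: y).

(** All terms but the first are rescaled to total weight 1, unless their weight is zero; then
    induction on the number of terms applies. *)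
Lemma convex_sum C n (w : 'I_n -> R) (x : 'I_n -> plane) :
  convex C -> (forall i, 0 <= w i) -> \sum_i w i = 1 -> (forall i, C (x i)) ->
  C (\sum_i w i *: x i).
Proof.
move=> cC; elim: n w x => [|n IH] w x w0 w1 Cx.
  by move/eqP: w1; rewrite big_ord0 eq_sym oner_eq0.
move: w1; rewrite !big_ord_recl => w1.
have sge : 0 <= \sum_(i < n) w (lift ord0 i) by apply: sumr_ge0.
have [wz|wn] := eqVneq (\sum_(i < n) w (lift ord0 i)) 0.
  have wi i : w (lift ord0 i) = 0.
    by apply: (psumr_eq0P _ wz).
  rewrite (_ : w ord0 = 1) ?scale1r; last by rewrite wz addr0 in w1.
  by rewrite big1 ?addr0// => i _; rewrite wi scale0r.
have e : 1 - w ord0 = \sum_(i < n) w (lift ord0 i) by rewrite -w1 addrC addKr.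
rewrite [X in _ + X](_ : _ = (1 - w ord0) *:
    \sum_(i < n) (w (lift ord0 i) / (1 - w ord0)) *: x (lift ord0 i)).
  apply: cC => //; last by rewrite w0 /= -w1 lerDl.
  apply: IH => // [i|]; rewrite e ?divr_ge0//.
  by rewrite -mulr_suml divff.
rewrite scaler_sumr; apply: eq_bigr => i _.
by rewrite scalerA mulrC divfK// e.
Qed.

Lemma conv_hull_min C s : convex C -> (forall v, v \in s -> C (embed R v)) ->
  conv_hull s `<=` C.
Proof.
move=> cC Cs _ [w [w0 w1 ->]]; apply: convex_sum => // i.
by apply/Cs/mem_nth.
Qed.

Lemma convex_conv_hull s : convex (conv_hull s).
Proof.
move=> _ _ t [w [w0 w1 ->]] [u [u0 u1 ->]] /andP[t0 t1].
exists (fun i => t * w i + (1 - t) * u i); split.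
- by move=> i; rewrite addr_ge0// mulr_ge0// subr_ge0.
- by rewrite big_split /= -!mulr_sumr w1 u1 !mulr1 addrC subrK.
- rewrite !scaler_sumr -big_split; apply: eq_bigr => i _ /=.
  by rewrite !scalerA scalerDl.
Qed.

Lemma mem_conv_hull s v : v \in s -> conv_hull s (embed R v).
Proof.
move=> vs; have si : (index v s < size s)%N by rewrite index_mem.
exists (fun i => (i == Ordinal si)%:R); split=> [i||].
- by rewrite ler0n.
- by rewrite (bigD1 (Ordinal si))//= eqxx big1 ?addr0// => i /negPf ->.
- rewrite (bigD1 (Ordinal si))//= eqxx big1 ?addr0 => [|i /negPf ->].
    by rewrite scale1r nth_index.
  by rewrite scale0r.
Qed.

Lemma embedD u v : embed R (u + v) = embed R u + embed R v.
Proof. exact: map_mxD. Qed.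

Lemma embed_inj : injective (embed R).
Proof.
move=> u v /matrixP uv; apply/matrixP => i j; have := uv i j.
by rewrite !mxE => /intr_inj.
Qed.

Lemma convex_preimage_add C (z : plane) : convex C -> convex [set x | C (x + z)].
Proof.
move=> cC x y t /= h1 h2 ht; have := cC _ _ t h1 h2 ht.
by rewrite !scalerDr addrACA -scalerDl [t + _]addrC subrK scale1r.
Qed.

(** Both inclusions come from minimality of the convex hull. For the second one, a single summand
    varies at a time, and the other is absorbed in a translate of the convex set. *)
Lemma conv_hull_sums s t :
  conv_hull [seq u + v | u <- s, v <- t] =
  [set x + y | x in conv_hull s & y in conv_hull t] :> set plane.
Proof.
apply/seteqP; split.
  apply: conv_hull_min => [|_ /allpairsP[[u v] /= [us vt ->]]].
    move=> _ _ r [x hx [y hy <-]] [x' hx' [y' hy' <-]] hr.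
    exists (r *: x + (1 - r) *: x'); first exact: convex_conv_hull.
    exists (r *: y + (1 - r) *: y'); first exact: convex_conv_hull.
    by rewrite !scalerDr addrACA.
  exists (embed R u); first exact: mem_conv_hull.
  by exists (embed R v); rewrite ?embedD//; apply: mem_conv_hull.
move=> _ [x hx [y hy <-]].
have cH := @convex_conv_hull [seq u + v | u <- s, v <- t].
apply: (conv_hull_min (convex_preimage_add (z := y) cH)) hx => u us /=.
rewrite addrC.
apply: (conv_hull_min (convex_preimage_add (z := embed R u) cH)) hy => v vt /=.
by rewrite addrC -embedD; apply: mem_conv_hull; apply: allpairs_f.
Qed.

Lemma conv_hull_affine (M : 'M[int]_2) (b : point) s :
  [set map_mx intr M *m x + embed R b | x in conv_hull s] =
  conv_hull [seq M *m v + b | v <- s].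
Proof.
have aff r (x y : plane) : map_mx intr M *m (r *: x + (1 - r) *: y) + embed R b =
    r *: (map_mx intr M *m x + embed R b) + (1 - r) *: (map_mx intr M *m y + embed R b).
  rewrite !scalerDr addrACA -scalerDl [r + (1 - r)]addrC subrK scale1r mulmxDr.
  by rewrite !scalemxAr.
have emb v : map_mx intr M *m embed R v + embed R b = embed R (M *m v + b).
  by rewrite embedD /embed map_mxM.
apply/seteqP; split.
  apply/image_subP; apply: conv_hull_min => [x y r hx hy hr|v vs].
    by rewrite aff; apply: convex_conv_hull.
  by rewrite emb; apply: mem_conv_hull; apply: map_f.
apply: conv_hull_min => [_ _ r [x hx <-] [y hy <-] hr|_ /mapP[v vs ->]].
  by exists (r *: x + (1 - r) *: y); rewrite ?aff//; apply: convex_conv_hull.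
by exists (embed R v); rewrite ?emb//; apply: mem_conv_hull.
Qed.

Lemma aff_dim_gt0P (A : set plane) :
  (0 < aff_dim A)%N <-> exists x y, [/\ A x, A y & x != y].
Proof.
split=> [h|[x [y [Ax Ay xy]]]].
  have [d /asboolP[x [D [Ax AD rD]]] d0] :
      exists2 d : 'I_3, `[< aff_dim_ge d A >] & (0 < d)%N.
    apply: contrapT => hn; move: h; rewrite ltnNge; apply/negP/negPn.
    apply/bigmax_leqP => d hd; rewrite leqNgt; apply/negP => d0.
    by apply: hn; exists d.
  have [j Dj] : exists j, col j D != 0.
    apply: contrapT => hn; move: d0; rewrite -rD lt0n mxrank_eq0 => /eqP; apply.
    apply/matrixP => i j; rewrite mxE; apply/eqP; apply: contra_notT hn => Dij.
    by exists j; apply: contraNneq Dij => /matrixP/(_ i 0); rewrite !mxE => ->.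
  exists x, (x + col j D); split => //.
  by rewrite -{1}[x]addr0 (inj_eq (addrI x)) eq_sym.
apply: (@leq_bigmax_cond _ _ (fun d : 'I_3 => d : nat) (Ordinal (isT : (1 < 3)%N))).
apply/asboolP; exists x, (y - x : 'M_(2, 1)); split=> //.
  by move=> j; rewrite (_ : col j _ = y - x) ?(addrC x) ?subrK//;
    apply/matrixP => i k; rewrite !mxE (ord1 j) (ord1 k).
apply/eqP; rewrite eqn_leq rank_leq_col lt0n mxrank_eq0 subr_eq0 eq_sym.
exact: xy.
Qed.

Lemma aff_dim_conv_hull_gt0 s : (0 < aff_dim (conv_hull s : set plane))%N <->
  exists u v, [/\ u \in s, v \in s & u != v].
Proof.
rewrite aff_dim_gt0P; split=> [[x [y [hx hy xy]]]|[u [v [us vs uv]]]]; last first.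
  exists (embed R u), (embed R v); split; try exact: mem_conv_hull.
  by rewrite (inj_eq embed_inj).
apply: contrapT => hn; case: s hx hy hn => [|u s] hx hy hn.
  by case: hx => w [_ /eqP]; rewrite big_ord0 eq_sym oner_eq0.
have hu : conv_hull (u :: s) `<=` [set embed R u].
  apply: conv_hull_min => [_ _ r -> -> _|v vs] /=.
    by rewrite -scalerDl addrC subrK scale1r.
  congr embed; apply/eqP; apply: contra_notT hn => vu.
  by exists v, u; rewrite mem_head.
by move: xy; rewrite (hu x hx) (hu y hy) eqxx.
Qed.

End ConvexHulls.

(** * Minkowski decompositions and zonotopes *)

Section Decompositions.
Variable R : realType.
Local Notation plane := 'cV[R]_2.
Implicit Types (P C : set plane) (s : seq point).

Definition lattice_trace C (v : point) : Prop := C (embed R v).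

(** Each summand is shrunk to a segment between two of its lattice points: [v - u] becomes a
    direction and [u] is added to the base point. Lists of indices allow summands to be removed one
    by one. *)
Lemma zonotope_of_sums (I : eqType) (Qs : I -> set plane) (r : seq I) C :
  uniq r ->
  (forall i, i \in r -> exists u v,
     [/\ Qs i (embed R u), Qs i (embed R v) & u != v]) ->
  (forall y, (forall i, i \in r -> Qs i (y i)) -> C (\sum_(i <- r) y i)) ->
  exists x V, [/\ 0 \notin V, size V = size r & zonotope_in (lattice_trace C) V x].
Proof.
elim: r C => [|i r IH] C /=.
  move=> _ _ /(_ (fun=> 0)); rewrite big_nil => h; exists 0, [::]; split=> //=.
  by rewrite /lattice_trace /embed map_mx0; apply: h.
move=> /andP[ir ur] hQ hC; have [u [v [hu hv uv]]] := hQ i (mem_head _ _).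
(* The remaining sum must stay in [C] with either end of the first segment added. *)
pose C' := [set z | C (embed R u + z) /\ C (embed R v + z)].
have [|y hy|x [V [V0 sV hV]]] := IH C' ur.
- by move=> j jr; apply: hQ; rewrite inE jr orbT.
- suff h w : Qs i (embed R w) -> C (embed R w + \sum_(j <- r) y j).
    by split; apply: h.
  move=> hw; have := hC (fun j => if j == i then embed R w else y j).
  rewrite big_cons eqxx (eq_big_seq y) => [|j jr].
    apply=> j; rewrite inE; case: eqVneq => [->//|_ /= jr]; exact: hy.
  by case: eqVneq ir => // <-; rewrite jr.
exists (x + u), (v - u :: V); split.
- by rewrite inE negb_or V0 andbT eq_sym subr_eq0 eq_sym.
- by rewrite /= sV.
- rewrite /= -addrA [u + _]addrC subrK -!zonotope_in_shift -zonotope_in_and.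
  apply: zonotope_in_mono hV => z [h1 h2].
  by rewrite /lattice_trace !embedD ![embed R z + _]addrC.
Qed.

Lemma summand_vertices (Q : set plane) : lattice_polytope Q -> (0 < aff_dim Q)%N ->
  exists u v, [/\ Q (embed R u), Q (embed R v) & u != v].
Proof.
move=> [s _ ->] /aff_dim_conv_hull_gt0[u [v [us vs uv]]].
by exists u, v; split=> //; apply: mem_conv_hull.
Qed.

Lemma size_index_enum_ord n : size (index_enum 'I_n) = n.
Proof. by rewrite -[RHS]card_ord cardT enumT. Qed.

Lemma zonotope_of_decomp (Q P : set plane) l (Qs : 'I_l -> set plane) :
  Q `<=` P -> minkowski_decomp Q Qs ->
  exists x V, [/\ 0 \notin V, size V = l & zonotope_in (lattice_trace P) V x].
Proof.
move=> QP [hQs eQ].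
have := @zonotope_of_sums _ Qs (index_enum 'I_l) P (index_enum_uniq _).
rewrite size_index_enum_ord; apply.
  by move=> i _; apply: summand_vertices; case: (hQs i).
move=> y hy; apply: QP; rewrite eQ; exists y => // i.
by apply: hy; rewrite mem_index_enum.
Qed.

Definition sum_lists (W : seq (seq point)) : seq point :=
  foldr (fun s t => [seq u + v | u <- s, v <- t]) [:: 0] W.

Lemma mem_sum_lists_cons S W z : z \in sum_lists (S :: W) <->
  exists u y, [/\ u \in S, y \in sum_lists W & z = u + y].
Proof.
split=> [/allpairsP[[u y] /= [? ? ?]]|[u [y [? ? ->]]]]; first by exists u, y.
exact: allpairs_f.
Qed.

Lemma minkowski_sum_conv_hull (W : seq (seq point)) :
  minkowski_sum (fun i : 'I_(size W) => conv_hull (nth [::] W i)) =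
  conv_hull (sum_lists W) :> set plane.
Proof.
elim: W => [|s W IH].
  apply/seteqP; split=> [_ [y _ <-]|z].
    have := @mem_conv_hull R [:: 0] 0 (mem_head _ _).
    by rewrite /embed map_mx0 big_ord0.
  have c0 : convex [set 0 : plane].
    by move=> _ _ t -> -> _ /=; rewrite !scaler0 addr0.
  move=> /(conv_hull_min c0) -> => [|v]; last by rewrite inE => /eqP ->; exact: map_mx0.
  by exists (fun=> 0); rewrite ?big_ord0// => -[].
rewrite /= conv_hull_sums -IH; apply/seteqP; split=> [_ [y hy <-]|].
  rewrite big_ord_recl; exists (y ord0); first exact: (hy ord0).
  exists (\sum_(i < size W) y (lift ord0 i)) => //.
  by exists (fun i => y (lift ord0 i)) => // i; apply: (hy (lift ord0 i)).
move=> _ [x hx [_ [y hy <-] <-]].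
exists (fun i => if unlift ord0 i is Some j then y j else x).
  by move=> i /=; case: unliftP => [j|] ->; [apply: hy|].
rewrite big_ord_recl unlift_none; congr (_ + _).
by apply: eq_bigr => i _; rewrite liftK.
Qed.

Lemma sum_lists_segments (A : point -> Prop) V x :
  zonotope_in A V x <->
  forall y, y \in sum_lists [seq [:: 0; v] | v <- V] -> A (x + y).
Proof.
elim: V x => [|v V IH] x.
  split=> [Ax y|/(_ 0 (mem_head _ _))]; last by rewrite addr0.
  by rewrite inE => /eqP ->; rewrite addr0.
rewrite [zonotope_in _ _ _]/= !IH map_cons; split=> [[h1 h2] z|h].
  move=> /mem_sum_lists_cons[u [y [uv hy ->]]].
  move: uv; rewrite !inE => /orP[]/eqP ->; first by rewrite add0r; apply: h1.
  by rewrite addrA; apply: h2.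
split=> y hy.
  by apply: h; apply/mem_sum_lists_cons; exists 0, y; rewrite mem_head add0r.
rewrite -addrA; apply: h; apply/mem_sum_lists_cons; exists v, y.
by rewrite !inE eqxx orbT.
Qed.

(** The set [S] supplies the vertices of one distinguished summand, and this serves both for a
    segment and for an exceptional triangle. By convexity of [P], it suffices that the sums of
    vertices lie in [P]. *)
Lemma decomp_of_zonotopes P (S : seq point) (V : seq point) :
  convex P -> (exists u v, [/\ u \in S, v \in S & u != v]) -> 0 \notin V ->
  (forall y, y \in S -> zonotope_in (lattice_trace P) V y) ->
  exists (Q : set plane) (Qs : 'I_(size V).+1 -> set plane),
    [/\ lattice_polytope Q, Q `<=` P, minkowski_decomp Q Qs &
     exists i, Qs i = conv_hull S].
Proof.
move=> cP hS V0 hV; pose W := S :: [seq [:: 0; v] | v <- V].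
have sW : size W = (size V).+1 by rewrite /= size_map.
rewrite -sW.
exists (conv_hull (sum_lists W)), (fun i => conv_hull (nth [::] W i)).
split; last by exists ord0.
- exists (sum_lists W) => //.
  have [u [_ [uS _ _]]] := hS.
  suff h : u + 0 \in sum_lists W by apply: contraTneq h => ->.
  apply/mem_sum_lists_cons; exists u, 0; split=> //.
  elim: V {V0 hV W sW} => [|v V IH]; first exact: mem_head.
  by apply/mem_sum_lists_cons; exists 0, 0; rewrite mem_head addr0.
- apply: conv_hull_min => // z /mem_sum_lists_cons[u [y [uS hy ->]]].
  exact: (sum_lists_segments _ _ _).1 (hV u uS) y hy.
- split; last by rewrite minkowski_sum_conv_hull.
  move=> i; have : nth [::] W i \in W by apply: mem_nth.
  rewrite inE => /predU1P[->|/mapP[v vV ->]].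
    split; last exact/aff_dim_conv_hull_gt0.
    by exists S => //; case: hS => u [v []]; case: (S).
  split; first by exists [:: 0; v].
  apply/aff_dim_conv_hull_gt0; exists 0, v; rewrite !inE !eqxx orbT; split=> //.
  by apply: contraNneq V0 => ->.
Qed.

Lemma decomp_of_zonotope P x V : convex P -> V != [::] -> 0 \notin V ->
  zonotope_in (lattice_trace P) V x ->
  exists (Q : set plane) (Qs : 'I_(size V) -> set plane),
    [/\ lattice_polytope Q, Q `<=` P & minkowski_decomp Q Qs].
Proof.
case: V => // v V cP _; rewrite inE negb_or => /andP[v0 V0] [h1 h2].
have [||y|Q [Qs [hQ QP hQs _]]] := @decomp_of_zonotopes P [:: x; x + v] V cP.
- exists x, (x + v); rewrite !inE !eqxx orbT; split=> //.
  by rewrite -{1}[x]addr0 (inj_eq (addrI x)).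
- exact: V0.
- by rewrite !inE => /orP[]/eqP ->.
- by exists Q, Qs.
Qed.

Lemma aff_dim_decomp_gt0 (Q : set plane) l (Qs : 'I_l.+1 -> set plane) :
  minkowski_decomp Q Qs -> (0 < aff_dim Q)%N.
Proof.
move=> /(zonotope_of_decomp (@subset_refl _ Q))[x [V [V0 sV hV]]].
case: V V0 sV hV => // v V; rewrite inE negb_or => /andP[v0 _] _ [].
move=> /zonotope_in_base h1 /zonotope_in_base h2.
apply/aff_dim_gt0P; exists (embed R x), (embed R (x + v)); split=> //.
by rewrite (inj_eq (@embed_inj R)) -{1}[x]addr0 (inj_eq (addrI x)).
Qed.

(** A zonotope in [P] is the sum of its segments. The bound [B] ensures that its Minkowski length,
    defined as a maximum, exists and can be compared with [l]. *)
Lemma full_minkowski_length_bound P B l : convex P ->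
  zonotope_size_le (lattice_trace P) B -> full_minkowski_length P l ->
  zonotope_size_le (lattice_trace P) l.
Proof.
move=> cP hB [_ hl] x V V0 hV; have [->//|Vn] := eqVneq V [::].
have [Q [Qs [hQ QP hQs]]] := decomp_of_zonotope cP Vn V0 hV.
have [||k hk] := @bounded_is_max
  [set k | exists Qs : 'I_k -> set plane, minkowski_decomp Q Qs] (size V) B.
- by exists Qs.
- move=> k [Qs' /(zonotope_of_decomp QP)[y [W [W0 <- hW]]]]; exact: hB hW.
apply: (@leq_trans k); first by case: hk => _; apply; exists Qs.
apply: hl; exists Q; split=> //; rewrite /minkowski_length ifN//.
case: V Vn {V0 hV} Qs hQs {hk} => // v V _ Qs /aff_dim_decomp_gt0.
by rewrite lt0n.
Qed.

(** Every decomposition inside [P] yields a zonotope with as many segments, so the bound on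
    zonotopes limits them all; a single point has length 0. *)
Lemma full_minkowski_length_of_decomp P (Q : set plane) l (Qs : 'I_l.+1 -> set plane) :
  zonotope_size_le (lattice_trace P) l.+1 ->
  lattice_polytope Q -> Q `<=` P -> minkowski_decomp Q Qs ->
  full_minkowski_length P l.+1.
Proof.
move=> hl hQ QP hQs; split.
  exists Q; split=> //; rewrite /minkowski_length ifN; last first.
    by rewrite -lt0n; apply: aff_dim_decomp_gt0 hQs.
  split; first by exists Qs.
  by move=> k [Qs' /(zonotope_of_decomp QP)[y [W [W0 <- hW]]]]; exact: hl hW.
move=> k [Q' [hQ' Q'P]]; rewrite /minkowski_length.
case: ifP => [_ ->//|_ [[Qs' hQs'] _]].
by have [y [W [W0 <- hW]]] := zonotope_of_decomp Q'P hQs'; exact: hl hW.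
Qed.

(** * Exceptional triangles in terms of their centroids *)

Lemma det2 (M : 'M[int]_2) : \det M = M 0 0 * M 1 1 - M 0 1 * M 1 0.
Proof.
rewrite (expand_det_row _ 0) !big_ord_recl big_ord0 /cofactor !det_mx11 !mxE /=.
rewrite (_ : lift 0 0 = 1 :> 'I_2); last exact/val_inj.
rewrite (_ : lift 1 0 = 0 :> 'I_2); last exact/val_inj.
by rewrite /= expr0 expr1 mul1r addr0 mulN1r mulrN.
Qed.

Lemma mulmx2E (M : 'M[int]_2) (u : point) i :
  (M *m u) i 0 = M i 0 * u 0 0 + M i 1 * u 1 0.
Proof.
rewrite mxE !big_ord_recl big_ord0 addr0.
by congr (_ + M _ _ * u _ _); exact/val_inj.
Qed.

Lemma pointE :
  ((forall (u v : point) (i : 'I_2), ((u + v) i 0 = u i 0 + v i 0)%R) *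
   (forall (u : point) (i : 'I_2), ((- u) i 0 = - u i 0)%R) *
   (forall (M : 'M[int]_2) (u : point) i,
      ((M *m u) i 0 = M i 0 * u 0 0 + M i 1 * u 1 0)%R) *
   (forall x y, (lpoint x y 0 0 = x)%R) * (forall x y, (lpoint x y 1 0 = y)%R))%type.
Proof. by do !split=> *; rewrite ?mulmx2E ?mxE. Qed.

Definition triangle (g a b : point) : seq point := [:: g + a; g + b; g - a - b].

(** The centroid of [T0] is [lpoint 1 1], and its vertices differ from it by the negatives of the
    two unit vectors and by their sum. So [- b] and [- a] are the columns of the matrix, and the
    cross product is its determinant up to sign. *)
Lemma exceptional_triangleP (T : set plane) : exceptional_triangle T <->
  exists g a b, cross a b ^+ 2 = 1 /\ T = conv_hull (triangle g a b).
Proof.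
split=> [[M [c [uM ->]]]|[g [a [b [ab ->]]]]].
  exists (M *m lpoint 1 1 + c), (- (M *m lpoint 0 1)), (- (M *m lpoint 1 0)); split.
    have detM : \det M ^+ 2 = 1 by move: uM; rewrite unitmxE => /orP[]/eqP ->.
    by rewrite -[RHS]detM det2 /cross !pointE; ring.
  rewrite /T0 conv_hull_affine /triangle /=; congr conv_hull.
  by congr [:: _; _; _]; apply: eq_point; rewrite !pointE; ring.
pose M : 'M[int]_2 := \matrix_(i, j) if j == 0 then - b i 0 else - a i 0.
exists M, (g + a + b); split.
  rewrite unitmxE; apply/orP; rewrite det2 !mxE /=.
  have -> : - b 0 0 * - a 1 0 - - a 0 0 * - b 1 0 = - cross a b by rewrite /cross; ring.
  move: ab; rewrite -(expr1n _ 2) => /eqP; rewrite eqf_sqr.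
  by case/orP => /eqP ->; [right|left].
rewrite /T0 conv_hull_affine /triangle /=; congr conv_hull.
by congr [:: _; _; _]; apply: eq_point; rewrite !pointE !mxE /=; ring.
Qed.

Lemma exceptional_zonotope_of_decomp P s : convex P ->
  (forall v, v \in s <-> P (embed R v)) ->
  has_exceptional_maximal_decomp P -> exists l, exceptional_zonotope (fun v => v \in s) l.
Proof.
move=> cP hs [l [Qs [[hl [Q [_ QP [hQs eQ]]]] [i]]]].
move=> /exceptional_triangleP[g [a [b [ab eT]]]].
have sP V x : zonotope_in (fun v => v \in s) V x <-> zonotope_in (lattice_trace P) V x.
  exact: zonotope_in_ext.
pose r := rem i (index_enum 'I_l).
(* The triangle is kept whole: [C] consists of the translations that carry its three vertices into
   [P], and only the other summands are shrunk to segments. *)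
pose C := [set z | forall t, t \in triangle g a b -> P (embed R t + z)].
have sr : (size r).+1 = l.
  rewrite size_rem ?mem_index_enum// size_index_enum_ord prednK//.
  exact: leq_ltn_trans (ltn_ord i).
have [|j _|y hy t ht|x [V [V0 sV hV]]] := @zonotope_of_sums _ Qs r C.
- by rewrite rem_uniq ?index_enum_uniq.
- by apply: summand_vertices; case: (hQs j).
- pose y' j := if j == i then embed R t else y j.
  have mr j : (j \in r) = (j != i).
    by rewrite mem_rem_uniq ?index_enum_uniq// inE mem_index_enum andbT.
  have <- : \sum_j y' j = embed R t + \sum_(j <- r) y j.
    rewrite (big_rem i) ?mem_index_enum//= {1}/y' eqxx; congr (_ + _).
    by apply: eq_big_seq => j; rewrite mr /y' => /negPf ->.
  apply: QP; rewrite eQ; exists y' => //.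
  move=> j; rewrite /y'; case: eqVneq => [->|ji]; last by apply: hy; rewrite mr.
  by rewrite eT; apply: mem_conv_hull.
exists (size r), (x + g), a, b, V; split=> //.
  apply/zonotope_in_shift; apply: zonotope_in_mono hV => z hz.
  have hz' t : t \in triangle g a b -> z + t \in s.
    by move=> /hz; rewrite -embedD addrC => /hs.
  by rewrite /fits_triangle -!addrA; split; apply: hz'; rewrite !inE ?addrA ?eqxx ?orbT.
rewrite sr => W y W0 /sP hW.
apply: (full_minkowski_length_bound cP _ hl) W0 hW => u U U0 /sP.
exact: zonotope_size_bounded.
Qed.

Lemma decomp_of_exceptional_zonotope P s l : convex P ->
  (forall v, v \in s <-> P (embed R v)) ->
  exceptional_zonotope (fun v => v \in s) l -> has_exceptional_maximal_decomp P.
Proof.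
move=> cP hs [g [a [b [V [ab V0 hV sV hl]]]]].
have sP W x : zonotope_in (fun v => v \in s) W x <-> zonotope_in (lattice_trace P) W x.
  exact: zonotope_in_ext.
have [h1 h2 h3] := (zonotope_in_fits _ _ _ _ _).1 hV.
have [||y|Q [Qs [hQ QP hQs [i Qi]]]] := @decomp_of_zonotopes P (triangle g a b) V cP.
- exists (g + a), (g + b); rewrite !inE !eqxx orbT; split=> //.
  by rewrite (inj_eq (addrI g)); apply: contra_eq_neq ab => ->;
    rewrite /cross mulrC subrr expr0n.
- exact: V0.
- by rewrite !inE => /or3P[]/eqP ->; apply/sP.
exists (size V).+1, Qs; split; last first.
  by exists i; apply/exceptional_triangleP; exists g, a, b.
split; last by exists Q.
apply: full_minkowski_length_of_decomp hQ QP hQs => x W W0 /sP; rewrite sV; exact: hl.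
Qed.

(** The centroid lies on the segment from one vertex to the midpoint of the other two, with weight
    one third at the vertex. *)
Lemma convex_centroid_closed P s : convex P -> (forall v, v \in s <-> P (embed R v)) ->
  centroid_closed (fun v => v \in s).
Proof.
move=> cP hs g a b /hs h1 /hs h2 /hs h3; apply/hs.
have h12 : P (2^-1 *: embed R (g + a) + (1 - 2^-1) *: embed R (g + b)).
  by apply: cP => //; apply/andP; split; lra.
have := cP _ _ 3^-1 h3 h12; rewrite (_ : _ + _ = embed R g); last first.
  by apply/matrixP => i j; rewrite !mxE !rmorphB !rmorphD /=; field.
by apply; apply/andP; split; lra.
Qed.

End Decompositions.

Theorem theorem3p3 (R : realType) :
  exists (c : cmd) (C k : nat),
    forall (P : set 'cV[R]_2) (s : seq 'cV[int]_2),
      lattice_polygon P -> lists_lattice_points s P ->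
      exists (t : nat) (st : state),
        [/\ exec c (input_state s) t st,
            (t <= C * size s ^ k)%N &
            accepts st <-> has_exceptional_maximal_decomp P].
Proof.
have [c [C [k h]]] := decides_exceptional_search.
(* The answer is moved from register 1 to register 0, which costs two operations. *)
exists (Seq c (Assign 0 (Reg 1))), (C + 2)%N, k => P s [[s0 s0n eP] _] [_ hs].
have cP : convex P by rewrite eP; apply: convex_conv_hull.
(* A polytope is the hull of a nonempty list, whose points appear in [s]. *)
have s_gt0 : (0 < size s)%N.
  have : P (embed R (head 0 s0)).
    by rewrite eP; apply: mem_conv_hull; case: (s0) s0n => // *; apply: mem_head.
  by move=> /hs; case: (s).
have rep : represents s [::] (input_state s) by split.
have [t [st [h1 h2 h3 h4]]] := h s [::] (input_state s) s_gt0 erefl rep.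
exists (t + 2)%N, (set_reg st 0 (regs st 1)); split.
- exact: ExecSeq h1 (ExecAssign _ (Reg 1) _).
- by have := expn_gt0 (size s) k; rewrite s_gt0 /= mulnDl; lia.
rewrite /accepts /= h4.
have -> : (if `[< exceptional_search s >] then 1 else 0) = 1 :> int <->
    exceptional_search s.
  by case: asboolP.
rewrite (exceptional_searchE (convex_centroid_closed cP hs)).
split; first by move=> [l]; apply: decomp_of_exceptional_zonotope.
exact: exceptional_zonotope_of_decomp.
Qed.
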